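(* Let $P\subset\mathbb{R}^n$ be a lattice polytope such that all the (complex) roots of its Ehrhart polynomial have real part $-\frac1a$, for some real $a>0$. Then: (i) For all $0\le s<t\le n$, \[\frac{\mathrm{G}_t(P)}{\mathrm{G}_s(P)}\le a^{t-s}\frac{\binom{n}{t}}{\binom{n}{s}}.\] For $(s,t)=(n-1,n)$ equality holds. For every $0\le s<t\le n$ with $(s,t)\neq(n-1,n)$, equality holds if and only if $\#(kP\cap\mathbb{Z}^n)=(ak+1)^n$ for all $k\in\mathbb{N}$. (ii) $\operatorname{vol}(P)\le\left(\frac{a}{a+1}\right)^n\#(P\cap\mathbb{Z}^n)$, with equality if and only if $\#(kP\cap\mathbb{Z}^n)=(ak+1)^n$ for all $k\in\mathbb{N}$. (iii) \[\#(P\cap\mathbb{Z}^n)\le\frac{(a+1)^{n-2}(a+2)}{a^{n-1}}\operatorname{vol}(P)+(a+1)^{n-2},\] with equality if and only if the Ehrhart polynomial of $P$ has at most one pair of complex conjugate roots with nonzero imaginary part. In particular, equality holds for $n\in\{2,3\}$.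
   Context: A lattice polytope in $\mathbb{R}^n$ is the convex hull of finitely many points of $\mathbb{Z}^n$ (here $n$-dimensional, as implicit in the Ehrhart polynomial having degree $n$). Its Ehrhart polynomial is the polynomial $\sum_{i=0}^n\mathrm{G}_i(P)k^i$ satisfying $\#(kP\cap\mathbb{Z}^n)=\sum_{i=0}^n\mathrm{G}_i(P)k^i$ for all $k\in\mathbb{N}$; it is regarded as a polynomial in a complex variable when speaking of its roots. $\mathrm{G}_n(P)=\operatorname{vol}(P)$ is the Lebesgue volume and $\mathrm{G}_0(P)=1$. *)

(* Defs.v *)
From HB Require Import structures.
From mathcomp Require Import all_boot all_order all_algebra.
From mathcomp Require Import finmap.
From mathcomp Require Import all_classical all_reals all_analysis.
From mathcomp Require Import complex.

Set Implicit Arguments.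
Unset Strict Implicit.
Unset Printing Implicit Defensive.

Import Order.TTheory GRing.Theory Num.Theory.
Import numFieldNormedType.Exports.

Local Open Scope classical_set_scope.
Local Open Scope ring_scope.

Section Geometry.
Variables (R : realType) (n : nat).
Implicit Types (A P : set 'rV[R]_n) (z : 'rV[int]_n).

Definition of_lattice z : 'rV[R]_n := map_mx intr z.

Definition convex_hull (m : nat) (v : 'I_m -> 'rV[R]_n) : set 'rV[R]_n :=
  [set x | exists w : 'I_m -> R,
     [/\ forall i, 0 <= w i, \sum_i w i = 1 & x = \sum_i w i *: v i]].

Definition affine_hull A : set 'rV[R]_n :=
  [set x | exists (m : nat) (v : 'I_m -> 'rV[R]_n) (w : 'I_m -> R),
     [/\ forall i, A (v i), \sum_i w i = 1 & x = \sum_i w i *: v i]].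

Definition full_dimensional A : Prop := affine_hull A = setT.

Definition lattice_polytope P : Prop :=
  exists (m : nat) (v : 'I_m -> 'rV[int]_n),
    P = convex_hull (fun i => of_lattice (v i)).

Definition dilate (c : R) A : set 'rV[R]_n := [set c *: x | x in A].

(* fset_set is empty on infinite sets; a bounded set such as a dilated
   polytope contains only finitely many lattice points. *)
Definition lattice_count A : nat := #|` fset_set [set z | A (of_lattice z)] |.

Definition open_box (a b : 'rV[R]_n) : set 'rV[R]_n :=
  [set x | forall i, a 0 i < x 0 i < b 0 i].

(* Lebesgue (outer) measure on R^n: infimum of the total volume of the at most
   countable covers by open boxes.  The covers are indexed by a subset D of nat
   because in dimension 0 the only box is the whole space, of volume 1. *)
Definition lebesgue_outer A : \bar R :=
  ereal_inf [set y | exists (D : pred nat) (a b : nat -> 'rV[R]_n),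
    [/\ forall k i, a k 0 i <= b k 0 i,
        A `<=` \bigcup_(k in [set k | D k]) open_box (a k) (b k) &
        y = (\sum_(0 <= k <oo | D k) (\prod_(i < n) (b k 0 i - a k 0 i))%:E)%E]].

(* Polytopes are compact, hence measurable of finite measure. *)
Definition vol A : R := fine (lebesgue_outer A).

(* Such a polynomial is unique, and it exists for every lattice polytope by
   Ehrhart's theorem; the default value 0 is used for other sets. *)
Definition ehrhart_poly P : {poly R} :=
  xget 0 [set p : {poly R} | (size p <= n.+1)%N /\
    forall k : nat, p.[k%:R] = (lattice_count (dilate k%:R P))%:R].

Definition ehrhart_coef P (i : nat) : R := (ehrhart_poly P)`_i.

Definition ehrhart_polyC P : {poly R[i]} :=
  map_poly (real_complex R) (ehrhart_poly P).

End Geometry.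

Section Roots.
Variable R : realType.
Implicit Type p : {poly R[i]}.

(* The roots repeated according to their multiplicities. *)
Definition complex_roots p : seq R[i] := sval (closed_field_poly_normal p).

Definition nonreal_roots p : seq R[i] :=
  [seq z <- complex_roots p | complex.Im z != 0].

Definition at_most_one_conjugate_pair p : Prop :=
  nonreal_roots p = [::] \/
  exists z : R[i], perm_eq (nonreal_roots p) [:: z; conjc z].

End Roots.

(* Main.v *)
(** If a polynomial [p] of degree [n] with [p(0) = 1] has all its roots on the line
[Re z = -1/a], then in the variable [y = a k + 1] it is a product of factors [y] and
[y^2 + b] with [b > 0]; expanding the product of the [Y + b] gives
[p(k) = sum_j c_j (a k + 1)^(n - 2j)] with positive [c_j] of sum 1, for [j] up to the number
of conjugate pairs of roots.  Every inequality then holds term by term, with equality exactly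
when the terms [j >= 1] (for (i) and (ii)) or [j >= 2] (for (iii)) are absent.

Ehrhart's theorem itself is not needed: if no counting polynomial existed, [ehrhart_poly]
would be 0 and every complex number would be a root.  That the volume is the leading
coefficient follows by comparing polynomials in [k]: the lattice points of [kP] inside a
finite cover by boxes bound the coefficient from above by the volume of the cover (a
countable cover of [P] has a finite subcover), and conversely [P] is covered by cubes of
side about [1/k], indexed by lattice points of [(k + c)P] where [cP] contains a lattice
translate of [[-1,1]^n]. *)
Require Import Defs.
From HB Require Import structures.
From mathcomp Require Import all_boot all_order all_algebra.
From mathcomp Require Import finmap.
From mathcomp Require Import all_classical all_reals all_analysis.
From mathcomp Require Import complex polyrcf.
From mathcomp Require Import ring lra zify.
Import Order.TTheory GRing.Theory Num.Theory.
Import numFieldNormedType.Exports.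
Local Open Scope classical_set_scope.
Local Open Scope ring_scope.

Set Implicit Arguments.
Unset Strict Implicit.
Unset Printing Implicit Defensive.

(** * Polynomials dominated at the natural numbers *)

Section PolynomialGrowth.
Variable R : realType.
Implicit Types p q : {poly R}.

(** A negative coefficient at [d] would be the leading one, so [- p] would be positive from some
    point on, against the sign hypothesis at a large integer. *)
Lemma top_coef_ge0 p (d k0 : nat) : (size p <= d.+1)%N ->
  (forall k : nat, (k0 <= k)%N -> 0 <= p.[k%:R]) -> 0 <= p`_d.
Proof.
move=> sp hp; rewrite leNgt; apply/negP => pd0.
have spE : size p = d.+1.
  apply/eqP; rewrite eqn_leq sp ltnNge; apply/negP => h.
  by rewrite nth_default ?ltxx // in pd0.
have lc : 0 < lead_coef (- p) by rewrite lead_coefN lead_coefE spE oppr_gt0.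
have [m hm] := poly_pinfty_gt_lc lc.
pose k := maxn k0 (Num.bound `|m|).
have mk : m <= k%:R.
  apply: (le_trans (ler_norm _)); apply: (le_trans (ltW (archi_boundP _))) => //.
  by rewrite ler_nat leq_maxr.
have := lt_le_trans lc (hm _ mk).
by rewrite hornerN oppr_gt0 ltNge hp // leq_maxl.
Qed.

(** This takes the place of limits: the volume estimates below come from inequalities between
    polynomials at positive integers. *)
Lemma le_top_coef p q (d k0 : nat) : (size p <= d.+1)%N -> (size q <= d.+1)%N ->
  (forall k : nat, (k0 <= k)%N -> p.[k%:R] <= q.[k%:R]) -> p`_d <= q`_d.
Proof.
move=> sp sq hpq; rewrite -subr_ge0 -coefB; apply: (@top_coef_ge0 _ _ k0).
  by apply: (leq_trans (size_polyD _ _)); rewrite size_polyN geq_max sp sq.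
by move=> k hk; rewrite hornerD hornerN subr_ge0 hpq.
Qed.

Lemma coefM_top p q (d e : nat) : (size p <= d.+1)%N -> (size q <= e.+1)%N ->
  (p * q)`_(d + e) = p`_d * q`_e.
Proof.
move=> sp sq; rewrite coefM.
have hd : (d < (d + e).+1)%N by rewrite ltnS leq_addr.
rewrite (bigD1 (Ordinal hd)) //= addKn big1 ?addr0 // => i neq.
have [lid|ldi|eid] := ltngtP (i : nat) d.
- by rewrite [q`_ _]nth_default ?mulr0 // (leq_trans sq) // ltn_subRL ltn_add2r.
- by rewrite [p`_ _]nth_default ?mul0r // (leq_trans sp).
- by case/eqP: neq; apply: val_inj.
Qed.

Lemma size_polyM_le p q (d e : nat) : (size p <= d.+1)%N -> (size q <= e.+1)%N ->
  (size (p * q)%R <= (d + e).+1)%N.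
Proof.
move=> sp sq; have /leq_trans := size_polyMleq p q; apply.
by rewrite -subn1 leq_subLR add1n -addnS -addSn leq_add.
Qed.

Lemma size_prod_le (I : Type) (s : seq I) (f : I -> {poly R}) :
  (forall i, (size (f i) <= 2)%N) -> (size (\prod_(i <- s) f i)%R <= (size s).+1)%N.
Proof.
move=> hf; elim: s => [|i s ih]; first by rewrite big_nil size_poly1.
by rewrite big_cons; apply: (@size_polyM_le _ _ 1 (size s)).
Qed.

Lemma coef_prod_top (I : Type) (s : seq I) (f : I -> {poly R}) :
  (forall i, (size (f i) <= 2)%N) ->
  (\prod_(i <- s) f i)`_(size s) = \prod_(i <- s) (f i)`_1.
Proof.
move=> hf; elim: s => [|i s ih]; first by rewrite !big_nil coef1.
by rewrite !big_cons -ih; apply: (@coefM_top _ _ 1 (size s)); rewrite ?size_prod_le.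
Qed.

Lemma size_XDC (c : R) : (size ('X + c%:P)%R <= 2)%N.
Proof. by rewrite size_XaddC. Qed.

Lemma coef_comp_XDC_top p (c : R) (d : nat) : (size p <= d.+1)%N ->
  (size (p \Po ('X + c%:P))%R <= d.+1)%N /\ (p \Po ('X + c%:P))`_d = p`_d.
Proof.
move=> sp; have sE : size (p \Po ('X + c%:P)) = size p.
  by rewrite size_comp_poly2 // size_XaddC.
rewrite sE; split=> //.
have [lt|] := ltnP (size p) d.+1; first by rewrite !nth_default ?sE.
move=> h; have spE : size p = d.+1 by apply/eqP; rewrite eqn_leq sp.
rewrite -[d]/(d.+1.-1) -{1}spE -sE -spE -!lead_coefE lead_coef_comp ?size_XaddC //.
by rewrite lead_coefXaddC expr1n mulr1.
Qed.

Lemma eq_poly_nat p q : (forall k : nat, p.[k%:R] = q.[k%:R]) -> p = q.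
Proof.
move=> h; apply/eqP; rewrite -subr_eq0; apply/eqP.
apply: (@roots_geq_poly_eq0 _ _ [seq k%:R | k <- iota 0 (size (p - q))]).
- by apply/allP => _ /mapP[k _ ->]; rewrite rootE !hornerE h subrr.
- rewrite map_inj_uniq ?iota_uniq // => i j /eqP.
  by rewrite eqr_nat => /eqP.
- by rewrite size_map size_iota.
Qed.

End PolynomialGrowth.

(** * Cross products of binomial coefficients *)

Lemma bin_cross_leq (m n s t : nat) : (m <= n)%N -> (s <= t)%N ->
  ('C(m, t) * 'C(n, s) <= 'C(n, t) * 'C(m, s))%N.
Proof.
move=> mn; elim: t => [|t ih]; first by rewrite leqn0 => /eqP ->; rewrite mulnC.
rewrite leq_eqVlt => /predU1P[->|]; first by rewrite mulnC.
(* By [(t + 1) C(m, t + 1) = (m - t) C(m, t)], and likewise for [n], the step from [t] to [t + 1]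
   only needs [m - t <= n - t]. *)
rewrite ltnS => /ih st; rewrite -(@leq_pmul2l t.+1) // !mulnA !mul_bin_left -!mulnA.
by rewrite leq_mul ?leq_sub2r.
Qed.

(** The last step from [t] to [t + 1] brings in the factors [m - t < n - t]; the binomials on the
    larger side are nonzero since [t < n] and [s <= m], so this step is strict. *)
Lemma bin_cross_ltn (m n s t : nat) : (m < n)%N -> (s < t <= n)%N -> (s <= m)%N ->
  ('C(m, t) * 'C(n, s) < 'C(n, t) * 'C(m, s))%N.
Proof.
case: t => // t mn /andP[st tn] sm.
rewrite -(@ltn_pmul2l t.+1) // !mulnA !mul_bin_left -!mulnA.
have := bin_cross_leq (ltnW mn) (st : (s <= t)%N).
move=> /(leq_mul (leqnn (m - t))) /leq_ltn_trans; apply.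
by rewrite ltn_pmul2r ?muln_gt0 ?bin_gt0 ?sm ?ltn_sub2r // ltnW.
Qed.

(** * Positive combinations of powers of [a k + 1] *)

Section PositiveCombination.
Variables (R : realFieldType) (a c : R) (E : nat -> R) (m r : nat).
Hypotheses (a_gt0 : 0 < a) (c_gt0 : 0 < c).
Hypothesis E_gt0 : forall j, (j <= m)%N -> 0 < E j.
Let n := (2 * m + r)%N.
(** The coefficient of [k ^ t] in [sum_j c E_j (a k + 1)^(2 j + r)], a polynomial of degree [n]. *)
Let G t : R := \sum_(j < m.+1) c * E j * (a ^+ t *+ 'C(2 * j + r, t)).

Let cE_gt0 (j : 'I_m.+1) : 0 < c * E j.
Proof. by rewrite mulr_gt0 ?E_gt0 // -ltnS. Qed.

Let le_n (j : 'I_m.+1) : (2 * j + r <= n)%N.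
Proof. by rewrite leq_add2r leq_mul2l /= -ltnS. Qed.

Lemma combination_coef_gt0 t : (t <= n)%N -> 0 < G t.
Proof.
move=> tn; rewrite /G big_ord_recr /= ltr_wpDl ?sumr_ge0 // => [j _|].
  by rewrite mulr_ge0 ?mulrn_wge0 ?exprn_ge0 ?(ltW a_gt0) // ltW ?(cE_gt0 (widen_ord _ j)).
by rewrite mulr_gt0 ?(cE_gt0 ord_max) // pmulrn_lgt0 ?exprn_gt0 // bin_gt0.
Qed.

(** Clearing denominators leaves a positively weighted sum of cross differences of binomials, whose
    signs are given by [bin_cross_leq] and [bin_cross_ltn]. *)
Let ratio_equiv s t : (s < t <= n)%N ->
  a ^+ (t - s) * ('C(n, t)%:R / 'C(n, s)%:R) - G t / G s =
  (\sum_(j < m.+1) c * E j * (a ^+ t *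
     (('C(n, t) * 'C(2 * j + r, s))%:R - ('C(2 * j + r, t) * 'C(n, s))%:R)))
   / (G s * 'C(n, s)%:R).
Proof.
move=> /andP[st tn]; have sn := ltnW (leq_trans st tn).
have Gs : G s != 0 by rewrite gt_eqF ?combination_coef_gt0.
have Bs : 'C(n, s)%:R != 0 :> R by rewrite pnatr_eq0 -lt0n bin_gt0.
apply: (mulIf (mulf_neq0 Gs Bs)); rewrite divfK ?mulf_neq0 // mulrBl.
have -> : a ^+ (t - s) * ('C(n, t)%:R / 'C(n, s)%:R) * (G s * 'C(n, s)%:R) =
   a ^+ (t - s) * 'C(n, t)%:R * G s by field.
have -> : G t / G s * (G s * 'C(n, s)%:R) = 'C(n, s)%:R * G t by field.
rewrite /G !mulr_sumr -sumrB; apply: eq_bigr => j _.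
have powE k : a ^+ k *+ 'C(2 * j + r, k) = a ^+ k * 'C(2 * j + r, k)%:R by rewrite mulr_natr.
rewrite !natrM !powE.
have -> : a ^+ t = a ^+ (t - s) * a ^+ s by rewrite -exprD subnK // ltnW.
move: (a ^+ (t - s)) (a ^+ s) ('C(n, t)%:R : R) ('C(n, s)%:R : R).
move: ('C(2 * j + r, t)%:R : R) ('C(2 * j + r, s)%:R : R) (E j) => x1 x2 x3 x4 x5 x6 x7.
by ring.
Qed.

Lemma combination_ratio_le s t : (s < t <= n)%N ->
  G t / G s <= a ^+ (t - s) * ('C(n, t)%:R / 'C(n, s)%:R).
Proof.
move=> stn; have /andP[st tn] := stn; have sn := ltnW (leq_trans st tn).
rewrite -subr_ge0 ratio_equiv //.
apply: divr_ge0; last by rewrite mulr_ge0 ?(ltW (combination_coef_gt0 sn)).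
apply: sumr_ge0 => j _; rewrite mulr_ge0 ?(ltW (cE_gt0 _)) // mulr_ge0 ?exprn_ge0 ?(ltW a_gt0) //.
by rewrite subr_ge0 ler_nat bin_cross_leq // ltnW.
Qed.

(** The term [j = m - 1], of degree [n - 2], suffices for strictness: [bin_cross_ltn] applies to it
    because [s <= n - 2]. *)
Lemma combination_ratio_lt s t : (s < t <= n)%N -> (0 < m)%N -> (s.+2 <= n)%N ->
  G t / G s < a ^+ (t - s) * ('C(n, t)%:R / 'C(n, s)%:R).
Proof.
move=> stn m_gt0 s2n; have /andP[st tn] := stn; have sn := ltnW (leq_trans st tn).
rewrite -subr_gt0 ratio_equiv //.
apply: divr_gt0; last by rewrite mulr_gt0 ?combination_coef_gt0 ?ltr0n ?bin_gt0.
have hj : (m.-1 < m.+1)%N by rewrite (leq_ltn_trans (leq_pred _)).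
have hn : (2 * m.-1 + r).+2 = n by rewrite /n; case: m m_gt0 => // k _; rewrite mulnS.
rewrite (bigD1 (Ordinal hj)) //= ltr_pwDl ?sumr_ge0 // => [|j _].
  rewrite mulr_gt0 ?(cE_gt0 (Ordinal hj)) // mulr_gt0 ?exprn_gt0 // subr_gt0 ltr_nat.
  apply: bin_cross_ltn => //=; first by rewrite -/n -hn.
  by rewrite -2!ltnS hn.
rewrite mulr_ge0 ?(ltW (cE_gt0 _)) // mulr_ge0 ?exprn_ge0 ?(ltW a_gt0) //.
by rewrite subr_ge0 ler_nat bin_cross_leq // ltnW.
Qed.

(** Terms with [j < m] have degree at most [n - 2] and miss both top coefficients; for [j = m] the
    cross difference is zero. *)
Lemma combination_ratio_top : (0 < n)%N ->
  G n / G n.-1 = a ^+ (n - n.-1) * ('C(n, n)%:R / 'C(n, n.-1)%:R).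
Proof.
move=> n_gt0; apply/esym/eqP; rewrite -subr_eq0 ratio_equiv ?leqnn ?andbT ?prednK //.
rewrite big_ord_recr /= big1 => [|j _]; last first.
  have jn : ((2 * j + r).+2 <= n)%N by have := ltn_ord j; rewrite /n; lia.
  rewrite !(@bin_small (2 * j + r)) ?muln0 ?mul0n ?subrr ?mulr0 //.
    exact: ltnW.
  by rewrite -ltnS prednK.
by rewrite -/n mulnC subrr !mulr0 addr0 mul0r.
Qed.

(** The value of the same polynomial at [k = 1], which will be the number of lattice points of the
    polytope. *)
Let H : R := \sum_(j < m.+1) c * E j * (a + 1) ^+ (2 * j + r).

Let a1_ge1 : 1 <= a + 1. Proof. by rewrite lerDr ltW. Qed.
Let a1_gt0 : 0 < a + 1. Proof. exact: lt_le_trans a1_ge1. Qed.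

Let GnE : G n = c * E m * a ^+ n.
Proof.
rewrite /G big_ord_recr /= -/n binn mulr1n big1 ?add0r // => j _.
by rewrite bin_small ?mulr0 // ltn_add2r ltn_mul2l /=.
Qed.

(** The factor [((a + 1) / a)^n] turns the leading coefficient of [(a k + 1)^n] into its value at
    [k = 1], so the term [j = m] cancels. *)
Let top_sub : H - G n * ((a + 1) / a) ^+ n = \sum_(j < m) c * E j * (a + 1) ^+ (2 * j + r).
Proof.
have -> : G n * ((a + 1) / a) ^+ n = c * E m * (a + 1) ^+ n.
  by rewrite GnE -mulrA -exprMn mulrCA divff ?gt_eqF // mulr1.
by rewrite /H big_ord_recr /= addrK.
Qed.

Let ratioK : (a / (a + 1)) ^+ n * ((a + 1) / a) ^+ n = 1.
Proof.
by rewrite -exprMn mulrA divfK ?gt_eqF // divff ?gt_eqF ?expr1n.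
Qed.

Let ratio_gt0 : 0 < (a / (a + 1)) ^+ n.
Proof. by rewrite exprn_gt0 ?divr_gt0. Qed.

Let volume_sub : (a / (a + 1)) ^+ n * H - G n =
  (a / (a + 1)) ^+ n * \sum_(j < m) c * E j * (a + 1) ^+ (2 * j + r).
Proof. by rewrite -top_sub mulrBr mulrCA ratioK mulr1. Qed.

Lemma combination_top_le : G n <= (a / (a + 1)) ^+ n * H.
Proof.
rewrite -subr_ge0 volume_sub mulr_ge0 ?(ltW ratio_gt0) ?sumr_ge0 // => j _.
by rewrite mulr_ge0 ?exprn_ge0 ?(ltW a1_gt0) // ltW // (cE_gt0 (widen_ord _ j)).
Qed.

Lemma combination_top_lt : (0 < m)%N -> G n < (a / (a + 1)) ^+ n * H.
Proof.
move=> m_gt0; rewrite -subr_gt0 volume_sub mulr_gt0 ?ratio_gt0 //.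
rewrite (bigD1 (Ordinal m_gt0)) //= ltr_pwDl ?sumr_ge0 // => [|j _].
  by rewrite mulr_gt0 ?exprn_gt0 // (cE_gt0 ord0).
by rewrite mulr_ge0 ?exprn_ge0 ?(ltW a1_gt0) // ltW // (cE_gt0 (widen_ord _ j)).
Qed.

Let bound : R := (a + 1) ^ (n%:Z - 2) * (a + 2) / a ^ (n%:Z - 1) * G n
               + (a + 1) ^ (n%:Z - 2).

Hypothesis G0 : G 0%N = 1.

(** By [G0] the weights [c E_j] sum to 1, so the constant [(a + 1)^(n - 2)] can be spread over all
    [j]. The term [j = m] then cancels because [a (a + 2) + 1 = (a + 1)^2]. *)
Let bound_sub : bound - H =
  \sum_(j < m) c * E j * ((a + 1) ^ (n%:Z - 2) - (a + 1) ^+ (2 * j + r)).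
Proof.
have sumE : \sum_(j < m) c * E j = 1 - c * E m.
  have -> : 1 = \sum_(j < m.+1) c * E j.
    by rewrite -G0; apply: eq_bigr => j _; rewrite expr0 bin0 mulr1.
  by rewrite big_ord_recr /= addrK.
under eq_bigr do rewrite mulrBr.
rewrite sumrB -mulr_suml sumE -top_sub /bound GnE.
have -> : a ^ (n%:Z - 1) = a ^+ n / a.
  by rewrite expfzDr ?gt_eqF // exprN1 -exprnP.
have -> : (a + 1) ^ (n%:Z - 2) = (a + 1) ^+ n / (a + 1) ^+ 2.
  by rewrite expfzDr ?gt_eqF // -exprnN.
rewrite expr_div_n; field.
by rewrite expf_neq0 ?gt_eqF.
Qed.

(** An index [j < m] forces [n >= 2], so the integer exponent [n - 2] is a natural number and
    [2 j + r] can be split off. *)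
Let bound_term (j : 'I_m) :
  (a + 1) ^ (n%:Z - 2) = (a + 1) ^+ (2 * j + r) * (a + 1) ^+ (2 * (m - j.+1)).
Proof.
rewrite -exprD; have -> : n%:Z - 2 = (2 * j + r + 2 * (m - j.+1))%N :> int.
  by apply/eqP; rewrite subr_eq; apply/eqP; have := ltn_ord j; rewrite /n; lia.
by [].
Qed.

Lemma combination_bound : H <= bound.
Proof.
rewrite -subr_ge0 bound_sub sumr_ge0 // => j _.
rewrite mulr_ge0 ?(ltW (cE_gt0 (widen_ord _ j))) // subr_ge0 (bound_term j).
by rewrite ler_peMr ?exprn_ge0 ?exprn_ege1 ?(ltW a1_gt0).
Qed.

(** The summand [j = m - 1] of [bound_sub] is zero, so nothing remains when [m <= 1]; for [m >= 2]
    the summand [j = 0] is positive. *)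
Lemma combination_bound_eq : (H == bound) = (m <= 1)%N.
Proof.
rewrite eq_sym -subr_eq0 bound_sub; have [m1|m2] := leqP m 1.
  rewrite big1 ?eqxx // => j _; rewrite (bound_term j).
  have -> : (m - j.+1 = 0)%N by have := ltn_ord j; lia.
  by rewrite muln0 mulr1 subrr mulr0.
apply/negbTE; rewrite gt_eqF // (bigD1 (Ordinal (ltnW m2))) //=.
rewrite ltr_pwDl ?sumr_ge0 // => [|j _].
  rewrite mulr_gt0 ?(cE_gt0 ord0) // subr_gt0 (bound_term (Ordinal (ltnW m2))).
  rewrite ltr_pMr ?exprn_gt0 // exprn_egt1 ?ltrDr //.
  by rewrite muln_eq0 /= subn_eq0 -ltnNge.
rewrite mulr_ge0 ?(ltW (cE_gt0 (widen_ord _ j))) // subr_ge0 (bound_term j).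
by rewrite ler_peMr ?exprn_ge0 ?exprn_ege1 ?(ltW a1_gt0).
Qed.

End PositiveCombination.

(** * Polynomials with all roots on a vertical line *)

Section LinePolynomials.
Variables (R : realType) (a : R).
Hypothesis a_gt0 : 0 < a.
Local Notation C := R[i].
Local Notation toC := (map_poly (real_complex R)).

(** In this variable the line [Re z = -1/a] becomes the imaginary axis. *)
Let y : {poly R} := 1 + a *: 'X.

Definition line_poly (c : R) (bs : seq R) (r : nat) : {poly R} :=
  c *: (\prod_(b <- bs) (y ^+ 2 + b%:P) * y ^+ r).

(** The solution of [a z + 1 = i sqrt b], hence a root of [y ^+ 2 + b] when [b >= 0]. *)
Definition line_root (b : R) : C := Complex (- (1 / a)) (Num.sqrt b / a).

Let a_neq0 : a != 0. Proof. by rewrite gt_eqF. Qed.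

Lemma map_line_linear :
  toC y = (real_complex R a) *: ('X - (real_complex R (- (1 / a)))%:P).
Proof.
rewrite /y rmorphD /= rmorph1 map_polyZ /= map_polyX rmorphN polyCN opprK scalerDr.
rewrite addrC -mul_polyC -[in X in _ = _ + X]mul_polyC -polyCM -rmorphM /= mul1r divff //.
Qed.

Lemma map_line_quadratic (b : R) : 0 <= b ->
  toC (y ^+ 2 + b%:P) = (real_complex R (a ^+ 2)) *:
    (('X - (line_root b)%:P) * ('X - (conjc (line_root b))%:P)).
Proof.
move=> b_ge0; rewrite rmorphD rmorphXn /= map_line_linear map_polyC /= -!mul_polyC.
set u := real_complex R (- (1 / a)); set v := line_root b.
have hv1 : v + conjc v = u + u.
  by apply/eqP; rewrite eq_complex /u /v /= addrN addr0 !eqxx.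
have hv2 : v * conjc v = u * u + real_complex R (b / a ^+ 2).
  apply/eqP; rewrite eq_complex /u /v /=; apply/andP; split; apply/eqP; last by ring.
  by rewrite -[in X in _ = X](sqr_sqrtr b_ge0); field.
have -> : ('X - v%:P) * ('X - (conjc v)%:P) = 'X ^+ 2 - (v + conjc v)%:P * 'X + (v * conjc v)%:P.
  by rewrite polyCD polyCM; ring.
rewrite hv1 hv2 !polyCD polyCM.
have -> : real_complex R b = real_complex R (a ^+ 2) * real_complex R (b / a ^+ 2).
  by rewrite -rmorphM /= mulrC divfK ?expf_neq0.
have -> : real_complex R (a ^+ 2) = real_complex R a * real_complex R a by rewrite -rmorphM.
by rewrite !polyCM; ring.
Qed.

(** Induction on the size, removing one real factor at a time: a real root must be [-1/a] and gives
    [y]; a nonreal root comes with its conjugate, since the coefficients are real, and the pair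
    gives [y ^+ 2 + b]. *)
Lemma line_poly_factorization (p : {poly R}) : p != 0 ->
  (forall z : C, root (toC p) z -> complex.Re z = - (1 / a)) ->
  exists c bs r, all (> 0) bs /\ p = line_poly c bs r.
Proof.
elim: (size p).+1 {-2}p (leqnn (size p).+1) => // N IH {}p; rewrite ltnS => sp p0 hp.
have step q d (q0 : p = q * d) (sd : (1 < size d)%N) :
    exists c bs r, all (> 0) bs /\ q = line_poly c bs r.
  have : q * d != 0 by rewrite -q0.
  rewrite mulf_eq0 negb_or => /andP[qn0 dn0].
  apply: IH => //; last first.
    by move=> z rz; apply: hp; rewrite q0 rmorphM rootM rz.
  apply: leq_trans sp; rewrite q0 size_mul // -(subnKC sd) !addnS /= ltnS leq_addr //.
have [sp1|sp1] := leqP (size p) 1.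
  exists p`_0, [::], 0%N; split=> //.
  by rewrite /line_poly big_nil mul1r expr0 alg_polyC -size1_polyC.
have [z rz] : exists z, root (toC p) z.
  by apply: closed_rootP; rewrite size_map_poly neq_ltn sp1 orbT.
have rez := hp z rz.
have [imz|imz] := eqVneq (complex.Im z) 0.
  have zE : z = real_complex R (- (1 / a)) by case: z rez imz {rz} => ? ? /= -> ->.
  have : 'X - (- (1 / a))%:P %| p.
    by move: rz; rewrite dvdp_XsubCl zE fmorph_root.
  move=> /dvdpP[q qE].
  have [||c [bs [r [hbs qE2]]]] := step (a^-1 *: q) y.
  - rewrite qE -scalerAl scalerAr scalerDr scalerA mulVf // scale1r.
    by congr (q * _); rewrite addrC polyCN opprK mul1r alg_polyC.
  - rewrite /y addrC size_polyDl ?size_scale ?size_polyX // size_poly1 //.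
  have qE3 : p = (a^-1 *: q) * y.
    rewrite qE -scalerAl scalerAr scalerDr scalerA mulVf // scale1r.
    by congr (q * _); rewrite addrC polyCN opprK mul1r alg_polyC.
  exists c, bs, r.+1; split=> //.
  by rewrite qE3 qE2 /line_poly -scalerAl -mulrA -exprSr.
(* Chosen so that [sqrt b / a] is the absolute value of the imaginary part of [z], that is,
   [line_root b] is [z] or its conjugate. *)
pose b := (complex.Im z * a) ^+ 2.
have b_gt0 : 0 < b by rewrite exprn_even_gt0 //= mulf_neq0.
have dvd : y ^+ 2 + b%:P %| p.
  rewrite -(dvdp_map (real_complex R)) map_line_quadratic ?ltW // dvdpZl; last first.
    by rewrite fmorph_eq0 expf_neq0.
  have rzc : root (toC p) (conjc z).
    rewrite -complex_root_conj -map_poly_comp.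
    by rewrite (eq_map_poly (g := real_complex R)) // => x /=; rewrite oppr0.
  have lrE : line_root b = z \/ line_root b = conjc z.
    rewrite /line_root /b sqrtr_sqr normrM (gtr0_norm a_gt0) mulfK // -rez.
    case: (z) => u v /=; have [v0|v0] := ger0P v; [by left|by right].
  have := @uniq_roots_dvdp _ (toC p) [:: line_root b; conjc (line_root b)].
  rewrite !big_cons big_nil mulr1; apply.
    by apply/andP; split; last (apply/andP; split=> //); case: lrE => ->; rewrite ?conjcK.
  rewrite uniq_rootsE /= andbT inE eq_complex /= eqxx /=.
  rewrite -addr_eq0 -mulrDl mulf_neq0 ?invr_eq0 // gt_eqF // addr_gt0 // sqrtr_gt0 //.
have [q qE] := dvdpP _ _ dvd.
have [||c [bs [r [hbs qE2]]]] := step q (y ^+ 2 + b%:P) => //.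
- have -> : y ^+ 2 + b%:P = (a ^+ 2) *: 'X ^+ 2 + (2 * a) *: 'X + (1 + b)%:P.
    rewrite /y -!mul_polyC !polyCD !polyCM; ring.
  rewrite -addrA size_polyDl ?size_scale ?expf_neq0 // ?size_polyXn //.
  rewrite (leq_ltn_trans (size_polyD _ _)) // gtn_max size_scale ?mulf_neq0 ?pnatr_eq0 //.
  by rewrite size_polyX /= (leq_ltn_trans (size_polyC_leq1 _)).
exists c, (b :: bs), r; split; first by rewrite /= b_gt0.
by rewrite qE qE2 /line_poly big_cons -scalerAl; congr (_ *: _); rewrite mulrC mulrA.
Qed.

(** A product of monic linear factors determines its list of roots up to order, so it is enough to
    split each quadratic factor. *)
Lemma complex_roots_line_poly (c : R) (bs : seq R) (r : nat) : c != 0 -> all (> 0) bs ->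
  perm_eq (complex_roots (toC (line_poly c bs r)))
    (flatten [seq [:: line_root b; conjc (line_root b)] | b <- bs]
       ++ nseq r (real_complex R (- (1 / a)))).
Proof.
move=> c0 hbs; rewrite /complex_roots; case: closed_field_poly_normal => s /= sE.
apply: prod_XsubC_eq.
set t := flatten _ ++ _.
have [d tE] : exists d : C, toC (line_poly c bs r) = d *: \prod_(z <- t) ('X - z%:P).
  exists (real_complex R c * (\prod_(b <- bs) real_complex R (a ^+ 2) * real_complex R a ^+ r)).
  have quadE : \prod_(b <- bs) toC (y ^+ 2 + b%:P) = (\prod_(b <- bs) real_complex R (a ^+ 2)) *:
      \prod_(z <- flatten [seq [:: line_root b; conjc (line_root b)] | b <- bs]) ('X - z%:P).
    rewrite big_flatten /= big_map -scaler_prod big_seq [RHS]big_seq.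
    apply: eq_bigr => b /(allP hbs) b0.
    by rewrite map_line_quadratic ?ltW // !big_cons big_nil mulr1.
  rewrite /line_poly map_polyZ rmorphM rmorphXn /= map_line_linear rmorph_prod quadE.
  rewrite /t big_cat /= big_nseq iter_mulr_1.
  by rewrite exprZn -scalerAl -scalerAr !scalerA mulrA.
have dE : lead_coef (toC (line_poly c bs r)) = d.
  by rewrite tE lead_coefZ (monicP (monic_prod_XsubC _ _ _)) mulr1.
have d0 : d != 0.
  rewrite -dE lead_coef_eq0 map_poly_eq0 /line_poly scaler_eq0 negb_or c0 /=.
  have y0 : y != 0 by rewrite -(map_poly_eq0 (real_complex R)) map_line_linear scaler_eq0
     fmorph_eq0 negb_or a_neq0 polyXsubC_eq0.
  rewrite mulf_neq0 ?expf_neq0 // prodf_seq_neq0; apply/allP => b /(allP hbs) b0 /=.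
  rewrite -(map_poly_eq0 (real_complex R)) map_line_quadratic ?ltW // scaler_eq0.
  by rewrite fmorph_eq0 negb_or expf_neq0 // mulf_neq0 ?polyXsubC_eq0.
by apply: (scalerI d0); rewrite -tE -dE -sE.
Qed.

Lemma nonreal_roots_line_poly (c : R) (bs : seq R) (r : nat) : c != 0 -> all (> 0) bs ->
  perm_eq (nonreal_roots (toC (line_poly c bs r)))
    (flatten [seq [:: line_root b; conjc (line_root b)] | b <- bs]).
Proof.
move=> c0 hbs; have := perm_filter (fun z : C => complex.Im z != 0) (complex_roots_line_poly r c0 hbs).
rewrite /nonreal_roots => /permPl ->; rewrite filter_cat filter_nseq /= eqxx cats0.
rewrite (_ : [seq _ <- _ | _] = flatten [seq [:: line_root b; conjc (line_root b)] | b <- bs]) //.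
elim: bs hbs => //= b bs IH /andP[b0 /IH ->].
by rewrite oppr_eq0 mulf_neq0 ?invr_eq0 // gt_eqF // sqrtr_gt0.
Qed.

(** Each [b] contributes exactly two nonreal roots, so counting them decides. *)
Lemma at_most_one_pair_line_poly (c : R) (bs : seq R) (r : nat) : c != 0 -> all (> 0) bs ->
  at_most_one_conjugate_pair (toC (line_poly c bs r)) <-> (size bs <= 1)%N.
Proof.
move=> c0 hbs; have hp := nonreal_roots_line_poly r c0 hbs.
have sz : size (nonreal_roots (toC (line_poly c bs r))) = (2 * size bs)%N.
  by rewrite (perm_size hp); elim: (bs) => //= b s ->; rewrite mulnS.
split=> [[h|[z h]]|].
- by move: sz; rewrite h /=; case: bs {hbs hp h} => //= ? ?; rewrite mulnS.
- by move: sz; rewrite (perm_size h) /=; case: bs {hbs hp h} => //= ? [|? ?] //=; rewrite !mulnS.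
- case: bs {hbs sz} hp => [|b [|//]] /= hp _; last by right; exists (line_root b).
  by left; apply/nilP; rewrite /nilp (perm_size hp).
Qed.

Lemma coef_line_power (N t : nat) : (y ^+ N)`_t = a ^+ t *+ 'C(N, t).
Proof.
rewrite /y exprDn coef_sum.
have -> : a ^+ t *+ 'C(N, t) = \sum_(i < N.+1) (if t == i then a ^+ t *+ 'C(N, t) else 0).
  rewrite -big_mkcond /=; have [tN|tN] := ltnP t N.+1.
    by rewrite (big_pred1 (Ordinal tN)).
  by rewrite bin_small // big1.
apply: eq_bigr => i _; rewrite expr1n mul1r exprZn coefMn coefZ coefXn.
by case: eqVneq => [->|_]; rewrite ?mulr1 // mulr0 mul0rn.
Qed.

(** These coefficients are the elementary symmetric functions of the positive numbers in [bs]. *)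
Lemma coef_prod_XDC_gt0 (bs : seq R) (j : nat) : all (> 0) bs -> (j <= size bs)%N ->
  0 < (\prod_(b <- bs) ('X + b%:P))`_j.
Proof.
elim: bs j => [|b bs IH] j /=; first by rewrite leqn0 big_nil => _ /eqP ->; rewrite coef1.
move=> /andP[b0 hbs]; rewrite big_cons mulrDl coefD coefXM coefCM; case: j => [|j] /= js.
  by rewrite add0r mulr_gt0 // IH.
rewrite ltr_pwDl ?IH // mulr_ge0 ?(ltW b0) //.
have [h|h] := leqP j.+1 (size bs); first by rewrite ltW ?IH.
by rewrite nth_default // (leq_trans (size_prod_le _ (@size_XDC R))).
Qed.

(** The product of the quadratic factors is the product of the [Y + b] evaluated at [Y = y ^+ 2]. *)
Lemma line_polyE (c : R) (bs : seq R) (r : nat) :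
  line_poly c bs r = \sum_(j < (size bs).+1) (c * (\prod_(b <- bs) ('X + b%:P))`_j) *: y ^+ (2 * j + r).
Proof.
rewrite /line_poly.
have -> : \prod_(b <- bs) (y ^+ 2 + b%:P) = (\prod_(b <- bs) ('X + b%:P)) \Po (y ^+ 2).
  by rewrite rmorph_prod; apply: eq_bigr => b _; rewrite /= comp_polyD comp_polyX comp_polyC.
rewrite comp_polyE.
have hs := size_prod_le bs (@size_XDC R).
rewrite (big_ord_widen_cond _ xpredT (fun i => (\prod_(b <- bs) ('X + b%:P))`_i *: y ^+ 2 ^+ i) hs).
rewrite big_mkcond /= mulr_suml scaler_sumr; apply: eq_bigr => j _.
case: ltnP => h; last by rewrite nth_default // mulr0 mul0r scaler0 scale0r.
by rewrite -scalerAl scalerA exprD exprM.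
Qed.

Lemma coef_line_poly (c : R) (bs : seq R) (r t : nat) :
  (line_poly c bs r)`_t =
  \sum_(j < (size bs).+1) c * (\prod_(b <- bs) ('X + b%:P))`_j * (a ^+ t *+ 'C(2 * j + r, t)).
Proof. by rewrite line_polyE coef_sum; apply: eq_bigr => j _; rewrite coefZ coef_line_power. Qed.

Lemma horner_line_poly (c : R) (bs : seq R) (r : nat) (x : R) :
  (line_poly c bs r).[x] =
  \sum_(j < (size bs).+1) c * (\prod_(b <- bs) ('X + b%:P))`_j * (a * x + 1) ^+ (2 * j + r).
Proof.
rewrite line_polyE horner_sum; apply: eq_bigr => j _.
by rewrite hornerZ horner_exp hornerD hornerZ hornerX hornerC addrC.
Qed.

End LinePolynomials.

(** * Counting lattice points *)

Section LatticePointsInBoxes.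
Variable n : nat.
Implicit Types (lo : 'I_n -> int) (N : 'I_n -> nat) (S : set 'rV[int]_n).

Definition int_box lo N : set 'rV[int]_n :=
  [set z | forall i, lo i <= z 0 i < lo i + (N i)%:Z].

(** The offsets from [lo] identify the box with a finite product of ordinals. *)
Lemma int_boxE lo N :
  exists2 F : {fset 'rV[int]_n}, int_box lo N = [set` F] & #|` F| = (\prod_i N i)%N.
Proof.
pose f (g : {dffun forall i, 'I_(N i)}) : 'rV[int]_n := \row_i (lo i + (g i : nat)%:Z).
have f_inj : injective f.
  move=> g h /rowP gh; apply/ffunP => i; apply: val_inj.
  by have := gh i; rewrite !mxE => /addrI [].
exists [fset z in [seq f g | g <- enum {dffun forall i, 'I_(N i)}]]%fset; last first.
  rewrite card_fseq undup_id ?(map_inj_uniq f_inj) ?enum_uniq // size_map -cardE.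
  rewrite card_dep_ffun foldrE big_image /=.
  by apply: eq_bigr => i _; rewrite card_ord.
apply/seteqP; split=> z /=; rewrite !inE; last first.
  by move=> /mapP[g _ ->] i; rewrite mxE lerDl /= ltrD2l ltz_nat ltn_ord.
move=> hz; have h i : (`|z 0%R i - lo i| < N i)%N.
  have /andP[h1 h2] := hz i.
  by rewrite -ltz_nat gez0_abs ?subr_ge0 // ltrBlDl.
apply/mapP; exists [ffun i => Ordinal (h i)]; first by rewrite mem_enum.
apply/rowP => i; rewrite mxE ffunE /= gez0_abs; last by rewrite subr_ge0; have /andP[] := hz i.
by rewrite subrKC.
Qed.

Lemma int_box_finite lo N : finite_set (int_box lo N).
Proof. by have [F -> _] := int_boxE lo N; exact: finite_fset. Qed.

Lemma card_int_box lo N : #|` fset_set (int_box lo N)| = (\prod_i N i)%N.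
Proof. by have [F -> <-] := int_boxE lo N; rewrite set_fsetK. Qed.

End LatticePointsInBoxes.

(** Finiteness of [B] matters: [fset_set] sends an infinite set to the empty one. *)
Lemma card_fset_set_le (T : choiceType) (A B : set T) :
  finite_set B -> A `<=` B -> (#|` fset_set A| <= #|` fset_set B|)%N.
Proof.
move=> fB AB; apply: fsubset_leq_card; rewrite -fset_set_sub //.
exact: sub_finite_set fB.
Qed.

Lemma card_fset_set_cover (T : choiceType) (I : Type) (J : seq I) (Q : pred I)
    (A : set T) (B : I -> set T) :
  (forall j, finite_set (B j)) ->
  A `<=` \big[setU/set0]_(j <- J | Q j) B j ->
  (#|` fset_set A| <= \sum_(j <- J | Q j) #|` fset_set (B j)|)%N.
Proof.
move=> fB AB.
have h : finite_set (\big[setU/set0]_(j <- J | Q j) B j) /\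
   (#|` fset_set (\big[setU/set0]_(j <- J | Q j) B j)| <= \sum_(j <- J | Q j) #|` fset_set (B j)|)%N.
  apply: (big_ind2 (fun X k => finite_set X /\ (#|` fset_set X| <= k)%N)) => //.
  - by split; [exact: finite_set0|rewrite fset_set0 cardfs0].
  - move=> X k Y l [fX hX] [fY hY]; split; first by rewrite finite_setU.
    by rewrite fset_setU // (leq_trans (leq_card_fsetU _ _)) // leq_add.
by case: h => fU hU; apply: leq_trans hU; exact: card_fset_set_le.
Qed.

(** * Dilates of a lattice polytope and full dimension *)

Section Polytope.
Variables (R : realType) (n m : nat) (v : 'I_m -> 'rV[int]_n).
Local Notation lat := (@of_lattice R n).
Let P : set 'rV[R]_n := convex_hull (fun i => lat (v i)).

Lemma of_latticeD (x z : 'rV[int]_n) : lat (x + z) = lat x + lat z.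
Proof. exact: map_mxD. Qed.

Lemma dilate1 (A : set 'rV[R]_n) : dilate 1 A = A.
Proof.
apply/seteqP; split=> [_ [x Ax <-]|x Ax]; first by rewrite scale1r.
by exists x => //; rewrite scale1r.
Qed.

Lemma dilate0 (A : set 'rV[R]_n) : A !=set0 -> dilate 0 A = [set 0].
Proof.
move=> [x Ax]; apply/seteqP; split=> [_ [y _ <-]|y ->]; first by rewrite /= scale0r.
by exists x => //; rewrite scale0r.
Qed.

Lemma dilate_hullP (c : R) (x : 'rV[R]_n) : 0 < c ->
  dilate c P x <->
  exists w : 'I_m -> R, [/\ forall i, 0 <= w i, \sum_i w i = c & x = \sum_i w i *: lat (v i)].
Proof.
move=> c0; split=> [[y [w [w0 w1 ->]] <-]|[w [w0 w1 ->]]].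
  exists (fun i => c * w i); split=> [i||]; first by rewrite mulr_ge0 ?(ltW c0).
    by rewrite -mulr_sumr w1 mulr1.
  by rewrite scaler_sumr; apply: eq_bigr => i _; rewrite scalerA.
exists (\sum_i (c^-1 * w i) *: lat (v i)).
  exists (fun i => c^-1 * w i); split=> // [i|]; first by rewrite mulr_ge0 ?invr_ge0 ?(ltW c0).
  by rewrite -mulr_sumr w1 mulVf ?gt_eqF.
by rewrite scaler_sumr; apply: eq_bigr => i _; rewrite scalerA mulVKf ?gt_eqF.
Qed.

Lemma dilate_hullD (c d : R) (x y : 'rV[R]_n) : 0 < c -> 0 < d ->
  dilate c P x -> dilate d P y -> dilate (c + d) P (x + y).
Proof.
move=> c0 d0 /(dilate_hullP _ c0)[w [w0 w1 ->]] /(dilate_hullP _ d0)[u [u0 u1 ->]].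
apply/dilate_hullP; first exact: addr_gt0.
exists (fun i => w i + u i); split=> [i||]; first exact: addr_ge0.
  by rewrite big_split /= w1 u1.
by rewrite -big_split /=; apply: eq_bigr => i _; rewrite scalerDl.
Qed.

Lemma dilateM (c d : R) (A : set 'rV[R]_n) (x : 'rV[R]_n) :
  dilate d A x -> dilate (c * d) A (c *: x).
Proof. by move=> [y Ay <-]; exists y => //; rewrite scalerA. Qed.

(** Each point of [P] is expanded in the vertices and the two sums are exchanged; the resulting
    weights may be negative. *)
Lemma affine_hull_weights (x : 'rV[R]_n) : affine_hull P x ->
  exists w : 'I_m -> R, \sum_i w i = 1 /\ x = \sum_i w i *: lat (v i).
Proof.
move=> [k [q [u [Pq u1 ->]]]].
have [l hl] := choice Pq.
exists (fun i => \sum_j u j * l j i); split.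
  rewrite exchange_big /= -u1; apply: eq_bigr => j _.
  by rewrite -mulr_sumr; have [_ -> _] := hl j; rewrite mulr1.
under [RHS]eq_bigr do rewrite scaler_suml.
rewrite exchange_big /=; apply: eq_bigr => j _.
have [_ _ {1}->] := hl j; rewrite scaler_sumr.
by apply: eq_bigr => i _; rewrite scalerA.
Qed.

Hypothesis P_full : full_dimensional P.

Lemma full_dimensional_gt0 : (0 < m)%N.
Proof.
have [w [w1 _]] : exists w : 'I_m -> R, \sum_i w i = 1 /\ 0 = \sum_i w i *: lat (v i).
  by apply: affine_hull_weights; rewrite P_full.
have [m0|//] := posnP m; move: w1; rewrite big1 => [/eqP|i _]; first by rewrite eq_sym oner_eq0.
by move: (leq_ltn_trans (leq0n i) (ltn_ord i)); rewrite m0.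
Qed.

Lemma full_dimensional_nonempty : P !=set0.
Proof.
(* The sum of the vertices is [m] times their barycenter. *)
suff [y Py _] : dilate m%:R P (\sum_(i < m) lat (v i)) by exists y.
apply/dilate_hullP; first by rewrite ltr0n full_dimensional_gt0.
exists (fun=> 1); split => //; first by rewrite sumr_const card_ord.
by apply: eq_bigr => i _; rewrite scale1r.
Qed.

(* Writing the basis vectors as combinations of the vertices with weight sum 0,
   a small perturbation of the barycenter keeps nonnegative weights. *)
Lemma full_dimensional_unit_cube : exists (c : nat) (u : 'rV[int]_n), (0 < c)%N /\
  forall x : 'rV[R]_n, (forall i, `|x 0 i| <= 1) -> dilate c%:R P (lat u + x).
Proof.
have hw x : exists w : 'I_m -> R, \sum_i w i = 1 /\ x = \sum_i w i *: lat (v i).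
  by apply: affine_hull_weights; rewrite P_full.
have [w0 [w01 w00]] := hw 0.
have [w ww] := choice (fun i : 'I_n => hw (delta_mx 0 i)).
pose d i j := w i j - w0 j.
have d0 i : \sum_j d i j = 0.
  by rewrite sumrB w01; have [-> _] := ww i; rewrite subrr.
have de i : \sum_j d i j *: lat (v j) = delta_mx 0 i.
  under eq_bigr do rewrite scalerBl.
  by rewrite sumrB -w00 subr0; have [_ <-] := ww i.
have [M M_gt0 hM] : exists2 M : nat, (0 < M)%N & \sum_i \sum_j `|d i j| <= M%:R.
  exists (Num.bound (\sum_i \sum_j `|d i j|)).+1 => //.
  apply: (le_trans (ltW (archi_boundP _))); last by rewrite ler_nat.
  by rewrite !sumr_ge0 // => i _; rewrite sumr_ge0.
(* Every vertex gets weight [M], which dominates any change of its weight caused by a vector with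
   coordinates in [[-1, 1]]; the total weight is [m * M] and the center is an integer point. *)
exists (m * M)%N, (\sum_j v j *+ M); split; first by rewrite muln_gt0 full_dimensional_gt0 M_gt0.
move=> x hx; apply/dilate_hullP; first by rewrite ltr0n muln_gt0 full_dimensional_gt0 M_gt0.
exists (fun j => M%:R + \sum_i x 0 i * d i j); split.
- move=> j; rewrite -lerBlDl sub0r lerNl; apply: le_trans hM.
  rewrite -sumrN; apply: ler_sum => i _; rewrite -mulNr.
  apply: (le_trans (ler_norm _)); rewrite normrM normrN.
  apply: (le_trans (ler_wpM2r _ (hx i))) => //; rewrite mul1r.
  by rewrite (bigD1 j) //= lerDl sumr_ge0.
- rewrite big_split /= sumr_const card_ord exchange_big /= big1 ?addr0 => [|i _].
    by rewrite natrM mulr_natl.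
  by rewrite -mulr_sumr d0 mulr0.
- under [RHS]eq_bigr do rewrite scalerDl.
  rewrite [RHS]big_split /=; congr (_ + _).
    rewrite /of_lattice raddf_sum; apply: eq_bigr => j _.
    by rewrite raddfMn scaler_nat.
  under [RHS]eq_bigr do rewrite scaler_suml.
  rewrite exchange_big /= {1}[x]row_sum_delta; apply: eq_bigr => i _.
  by rewrite -de scaler_sumr; apply: eq_bigr => j _; rewrite scalerA.
Qed.

End Polytope.

(** * The volume is the leading coefficient *)

Section FiniteSubcover.
Variables (R : realType) (n m : nat) (v : 'I_m -> 'rV[R]_n).

Lemma continuous_coord_sum (c : 'I_m -> R) :
  continuous (fun w : 'rV[R]_m => \sum_i w 0 i * c i).
Proof.
apply: continuous_big => [|i _ w]; first exact: add_continuous.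
by apply: continuousM; [exact: coord_continuous | exact: cst_continuous].
Qed.

Lemma open_coord_sum (c : 'I_m -> R) (x y : R) :
  open [set w : 'rV[R]_m | x < \sum_i w 0 i * c i < y].
Proof.
have -> : [set w : 'rV[R]_m | x < \sum_i w 0 i * c i < y] =
    (fun w : 'rV[R]_m => \sum_i w 0 i * c i) @^-1` `]x, y[%classic.
  by apply/seteqP; split=> w /=; rewrite in_itv.
by apply: open_comp => [w _|]; [exact: continuous_coord_sum | exact: itv_open].
Qed.

Lemma compact_simplex :
  compact ([set w : 'rV[R]_m | forall i, `[0, 1]%classic (w 0 i)] `&`
           [set w | \sum_i w 0 i = 1]).
Proof.
apply: compact_closedI.
  by apply: (@rV_compact R m (fun=> `[0, 1]%classic)) => i; exact: segment_compact.
rewrite [X in closed X](_ : _ = (fun w : 'rV[R]_m => \sum_i w 0 i * 1) @^-1` [set 1]).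
  by apply: closed_comp => [w _|]; [exact: continuous_coord_sum | exact: closed_eq].
have sumE (w : 'rV[R]_m) : \sum_i w 0 i * 1 = \sum_i w 0 i.
  by apply: eq_bigr => i _; rewrite mulr1.
by apply/seteqP; split=> w /=; rewrite sumE.
Qed.

(** The hull is the image of the compact simplex of weights under a continuous map, so the cover is
    pulled back to the simplex and a finite subcover is taken there. *)
Lemma hull_finite_subcover (D : pred nat) (a b : nat -> 'rV[R]_n) :
  convex_hull v `<=` \bigcup_(k in [set k | D k]) open_box (a k) (b k) ->
  exists N, convex_hull v `<=` \big[setU/set0]_(0 <= k < N | D k) open_box (a k) (b k).
Proof.
move=> cov; have := compact_simplex; rewrite compact_cover.
pose f (w : 'rV[R]_m) := \sum_i w 0 i *: v i.
pose B k := f @^-1` open_box (a k) (b k).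
move=> /(_ nat [set k | D k] B) [k _|w [w0 w1]|D' D'D covD'].
- pose H j := [set w : 'rV[R]_m | a k 0 j < \sum_i w 0 i * v i 0 j < b k 0 j].
  have fE w j : f w 0 j = \sum_i w 0 i * v i 0 j.
    by rewrite summxE; apply: eq_bigr => i _; rewrite mxE.
  have -> : B k = [set w | forall j, H j w].
    by apply/seteqP; split=> w /= h j; have := h j; rewrite /= fE.
  rewrite openE => w /= hw; apply: (@filter_forall _ _ H (nbhs w)) => j.
  by apply: open_nbhs_nbhs; split; [exact: open_coord_sum | exact: hw].
- apply: cov; exists (w 0); split=> // i.
  by have := w0 i; rewrite /= in_itv /= => /andP[].
(* One more than the largest index used by the finite subcover. *)
exists (\max_(k <- D') k).+1 => x [w [w0 w1 xE]].
have [|k kD' hk] := covD' (\row_i w i).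
  split=> [i|] /=; last by under eq_bigr do rewrite mxE.
  by rewrite mxE in_itv /= w0 /= -w1 (bigD1 i) //= lerDl sumr_ge0.
rewrite -bigcup_seq_cond; exists k.
  rewrite /= mem_index_iota /= ltnS (leq_bigmax_seq k) //.
  by have := D'D _ kD'; rewrite inE.
have xf : x = f (\row_i w i) by rewrite xE; apply: eq_bigr => i _; rewrite mxE.
by rewrite xf.
Qed.

End FiniteSubcover.

Section OuterMeasure.
Variables (R : realType) (n : nat).
Implicit Types a b : nat -> 'rV[R]_n.

Lemma lebesgue_outer_le (A : set 'rV[R]_n) (N : nat) a b :
  (forall k i, a k 0 i <= b k 0 i) ->
  A `<=` \big[setU/set0]_(0 <= k < N) open_box (a k) (b k) ->
  (lebesgue_outer A <= (\sum_(0 <= k < N) \prod_(i < n) (b k 0 i - a k 0 i))%:E)%E.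
Proof.
move=> ab cov; apply: ereal_inf_lbound.
have p_ge0 k : (0 <= (\prod_(i < n) (b k 0 i - a k 0 i))%:E)%E.
  by rewrite lee_fin prodr_ge0 // => i _; rewrite subr_ge0.
(* Cutting the index set, rather than padding with empty boxes, also works in dimension 0, where
   every box has volume 1. *)
exists (fun k => (k < N)%N), a, b; split=> //.
  move=> x /cov; rewrite -bigcup_seq => -[k]; rewrite /= mem_index_iota /= => kN xk.
  by exists k.
rewrite (@nneseries_split_cond _ _ 0 N) // add0n eseries0 => [|k Nk]; last first.
  by rewrite ltnNge Nk.
rewrite adde0 -sumEFin big_nat_cond [RHS]big_nat_cond.
by apply: eq_bigl => k; rewrite andbT; case: (k < N)%N.
Qed.

(** Compactness reduces a countable cover to finitely many of its boxes, and a partial sum of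
    nonnegative volumes is at most the series. *)
Lemma hull_lebesgue_outer_ge (m : nat) (v : 'I_m -> 'rV[R]_n) (V : R) :
  (forall (N : nat) (D : pred nat) a b, (forall k i, a k 0 i <= b k 0 i) ->
     convex_hull v `<=` \big[setU/set0]_(0 <= k < N | D k) open_box (a k) (b k) ->
     V <= \sum_(0 <= k < N | D k) \prod_(i < n) (b k 0 i - a k 0 i)) ->
  (V%:E <= lebesgue_outer (convex_hull v))%E.
Proof.
move=> hV; apply: le_ereal_inf_tmp => _ [D [a [b [ab cov ->]]]].
have [N covN] := hull_finite_subcover cov.
apply: (@le_trans _ _ (\sum_(0 <= k < N | D k) (\prod_(i < n) (b k 0 i - a k 0 i))%:E)%E).
  by rewrite sumEFin lee_fin; exact: hV covN.
apply: nneseries_lim_ge => k _ _.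
by rewrite lee_fin prodr_ge0 // => i _; rewrite subr_ge0.
Qed.

End OuterMeasure.

Section Volume.
Variables (R : realType) (n m : nat) (v : 'I_m -> 'rV[int]_n).
Local Notation lat := (@of_lattice R n).
Let P : set 'rV[R]_n := convex_hull (fun i => lat (v i)).

(** Each coordinate is at most [k] times the sum of the absolute values of all vertex coordinates,
    so the points lie in an integer box. *)
Lemma finite_lattice_points (k : R) : 0 < k -> finite_set [set z | dilate k P (lat z)].
Proof.
move=> k0; pose B := Num.bound (\sum_i \sum_j k * `|lat (v i) 0 j|).
apply: sub_finite_set (int_box_finite (fun=> - B%:Z) (fun=> (B + B).+1)) => z.
move=> /(dilate_hullP _ _ k0)[w [w0 w1 zE]] j.
suff : `|z 0 j| <= B%:Z by lia.
rewrite -(ler_int R) intr_norm /=.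
have -> : (z 0 j)%:~R = lat z 0 j by rewrite mxE.
rewrite zE summxE; apply: (le_trans (ler_norm_sum _ _ _)).
apply: le_trans (ltW (archi_boundP _)); last first.
  by rewrite !sumr_ge0 // => i _; rewrite sumr_ge0 // => l _; rewrite mulr_ge0 // ltW.
apply: ler_sum => i _; rewrite mxE normrM (ger0_norm (w0 i)).
apply: (@le_trans _ _ (k * `|lat (v i) 0 j|)).
  by rewrite ler_wpM2r // -w1 (bigD1 i) //= lerDl sumr_ge0.
rewrite (bigD1 j) //= lerDl sumr_ge0 // => l _; rewrite mulr_ge0 //; exact: ltW.
Qed.

(** An open interval contains at most its length plus one integers; this excess is the constant 1 in
    the linear factors of [top_coef_le_cover]. *)
Lemma int_of_open_itv (a b : R) (z : int) : a < z%:~R < b ->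
  Num.floor a + 1 <= z < Num.floor a + 1 + (Num.truncn (b - a)).+1%:Z.
Proof.
move=> /andP[az zb]; apply/andP; split.
  by rewrite lezD1 -(ltr_int R) (le_lt_trans (floor_le a)).
rewrite -(ltr_int R) intrD -pmulrn.
have h1 := floorD1_gt a; have h2 := truncnS_gt (b - a); lra.
Qed.

Variable p : {poly R}.
Hypothesis size_p : (size p <= n.+1)%N.
Hypothesis p_count : forall k : nat, p.[k%:R] = (lattice_count (dilate k%:R P))%:R.

Lemma top_coef_le_cover (N : nat) (D : pred nat) (a b : nat -> 'rV[R]_n) :
  (forall k i, a k 0 i <= b k 0 i) ->
  P `<=` \big[setU/set0]_(0 <= j < N | D j) open_box (a j) (b j) ->
  p`_n <= \sum_(0 <= j < N | D j) \prod_(i < n) (b j 0 i - a j 0 i).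
Proof.
move=> ab cov.
(* At [k], each factor bounds the number of integers in a side scaled by [k], so [q] dominates the
   lattice count of [k P]; its coefficient at [n] is the volume of the cover. *)
pose q := \sum_(0 <= j < N | D j) \prod_(i < n) ((b j 0 i - a j 0 i) *: 'X + 1).
have size_lin (c : R) : (size (c *: 'X + 1)%R <= 2)%N.
  apply: (leq_trans (size_polyD _ _)); rewrite size_poly1 geq_max andbT.
  by apply: (leq_trans (size_scale_leq _ _)); rewrite size_polyX.
have size_I : size (index_enum 'I_n) = n by rewrite [index_enum _]unlock -enumT size_enum_ord.
have size_prod j : (size (\prod_(i < n) ((b j 0 i - a j 0 i) *: 'X + 1))%R <= n.+1)%N.
  by rewrite -[X in (_ <= X.+1)%N]size_I size_prod_le.
have -> : \sum_(0 <= j < N | D j) \prod_(i < n) (b j 0 i - a j 0 i) = q`_n.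
  rewrite coef_sum; apply: eq_bigr => j _.
  rewrite -[X in _`_X]size_I coef_prod_top //.
  by apply: eq_bigr => i _; rewrite coefD coefZ coefX coef1 mulr1 addr0.
apply: (@le_top_coef _ _ _ _ 1) => // [|k k_gt0].
  by apply: (big_ind (fun r : {poly R} => (size r <= n.+1)%N));
    rewrite ?size_poly0 // => x y hx hy; rewrite (leq_trans (size_polyD _ _)) // geq_max hx.
have k0 : 0 < k%:R :> R by rewrite ltr0n.
pose B j := int_box (fun i => Num.floor (k%:R * a j 0 i) + 1)
  (fun i => (Num.truncn (k%:R * b j 0 i - k%:R * a j 0 i)).+1).
have covB : [set z | dilate k%:R P (lat z)] `<=` \big[setU/set0]_(0 <= j < N | D j) B j.
  move=> z [x /cov]; rewrite -!bigcup_seq_cond => -[j jN xj] xz; exists j => // i.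
  apply: int_of_open_itv; have -> : (z 0 i)%:~R = lat z 0 i by rewrite mxE.
  by rewrite -xz mxE !ltr_pM2l.
rewrite p_count.
apply: (@le_trans _ _ (\sum_(0 <= j < N | D j) #|` fset_set (B j)|)%:R).
  by rewrite ler_nat; apply: card_fset_set_cover covB => j; exact: int_box_finite.
rewrite natr_sum horner_sum; apply: ler_sum => j _.
rewrite card_int_box natr_prod horner_prod; apply: ler_prod => i _.
rewrite ler0n hornerD hornerZ hornerX hornerC -natr1 lerD2r.
by rewrite -mulrBr mulrC truncn_le mulr_ge0 // subr_ge0.
Qed.

Hypothesis P_full : full_dimensional P.

(** The dilate [c k P] contains at least [k ^ n] lattice points, so the top coefficient of [p(c X)]
    is at least that of ['X ^+ n]. *)
Lemma top_coef_gt0 : 0 < p`_n.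
Proof.
have [c [u [c_gt0 hc]]] := full_dimensional_unit_cube P_full.
suff : 1 <= p`_n * c%:R ^+ n.
  move=> /(lt_le_trans ltr01); rewrite pmulr_lgt0 // exprn_gt0 // ltr0n //.
have -> : p`_n * c%:R ^+ n = (p \Po (c%:R *: 'X))`_n.
  rewrite comp_polyE coef_sum.
  under eq_bigr do rewrite exprZn scalerA coefZ coefXn.
  have [h|h] := ltnP n (size p).
    rewrite (bigD1 (Ordinal h)) //= eqxx mulr1 big1 ?addr0 // => i ni.
    by rewrite [n == _](_ : _ = false) ?mulr0 //; apply: contraNF ni => /eqP ni; apply/eqP/val_inj.
  rewrite nth_default // mul0r big1 // => i _.
  by rewrite gtn_eqF ?mulr0 // (leq_trans (ltn_ord i)).
have Xn1 : ('X ^+ n : {poly R})`_n = 1 by rewrite coefXn eqxx.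
rewrite -[leLHS]Xn1.
apply: (@le_top_coef _ _ _ _ 1) => [||k k_gt0].
- by rewrite size_polyXn.
- apply: (leq_trans (size_comp_poly_leq _ _)); rewrite ltnS.
  have sX : ((size (c%:R *: 'X : {poly R})).-1 <= 1)%N.
    by rewrite size_scale ?size_polyX // pnatr_eq0 -lt0n.
  apply: (@leq_trans ((size p).-1 * 1)%N); first by rewrite leq_mul2l sX orbT.
  rewrite muln1.
  by move: size_p; case: (size p).
have k0 : 0 < k%:R :> R by rewrite ltr0n.
rewrite hornerXn horner_comp hornerZ hornerX -natrM p_count -natrX ler_nat.
have -> : (k ^ n = \prod_(i < n) k)%N by rewrite prod_nat_const card_ord.
(* These [k ^ n] integer points start at [k u] and stay in the cube of half-side [k] around it,
   which lies in [c k P]. *)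
rewrite -(card_int_box (fun i => u 0 i *+ k) (fun=> k)).
apply: card_fset_set_le; first by apply: finite_lattice_points; rewrite ltr0n muln_gt0 c_gt0.
move=> z hz /=.
have -> : lat z = k%:R *: (lat u + k%:R^-1 *: (lat z - k%:R *: lat u)).
  by rewrite scalerDr scalerA divff ?gt_eqF // scale1r addrC subrK.
rewrite natrM mulrC; apply/dilateM/hc => i.
have /andP[h1 h2] := hz i.
rewrite !mxE normrM ger0_norm ?invr_ge0 ?ler0n // ler_pdivrMl // mulr1 ler_norml.
have -> : k%:R * (u 0 i)%:~R = (u 0 i *+ k)%:~R :> R by rewrite rmorphMn mulr_natl.
rewrite -intrB -[k%:R]/(k%:Z%:~R) -intrN !ler_int; lia.
Qed.

Lemma lebesgue_outer_le_count : exists2 c : nat, (0 < c)%N & forall k : nat, (0 < k)%N ->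
  (lebesgue_outer P <= (p.[(k + c)%:R] * (k.+1%:R / k%:R ^+ 2) ^+ n)%:E)%E.
Proof.
have [c [u [c_gt0 hc]]] := full_dimensional_unit_cube P_full.
exists c => // k k_gt0.
have k0 : 0 < k%:R :> R by rewrite ltr0n.
have fin : finite_set [set z | dilate (k + c)%:R P (lat z)].
  by apply: finite_lattice_points; rewrite ltr0n addn_gt0 k_gt0.
pose s : seq 'rV[int]_n := fset_set [set z | dilate (k + c)%:R P (lat z)].
(* The boxes are cells of side [1/k], extended by [1/k^2] on the lower side so that an open box
   contains the half-open cell. Subtracting [u] undoes the translation in
   [full_dimensional_unit_cube]. *)
pose a j : 'rV[R]_n := \row_i ((((nth 0 s j - u) 0 i)%:~R - k%:R^-1) / k%:R).
pose b j : 'rV[R]_n := \row_i ((((nth 0 s j - u) 0 i)%:~R + 1) / k%:R).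
have ab_sub j i : b j 0 i - a j 0 i = k.+1%:R / k%:R ^+ 2.
  by rewrite !mxE -natr1; field; rewrite gt_eqF.
apply: (le_trans (@lebesgue_outer_le _ _ _ (size s) a b _ _)).
- by move=> j i; rewrite -subr_ge0 ab_sub divr_ge0 ?exprn_ge0.
- move=> x Px; rewrite -bigcup_seq.
  (* Since [z - k x] has coordinates in [(-1, 0]], the point [u + (z - k x)] lies in [c P], and
     adding [k x] puts [z + u] into [(k + c) P]. *)
  pose z : 'rV[int]_n := \row_i Num.floor (k%:R * x 0 i).
  have zu_s : z + u \in s.
    rewrite /s in_fset_set // inE /=.
    have -> : lat (z + u) = k%:R *: x + (lat u + (lat z - k%:R *: x)).
      by rewrite of_latticeD addrCA addrC [k%:R *: x + _]addrC subrK.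
    rewrite natrD; apply: dilate_hullD; rewrite ?ltr0n //; first by exists x.
    apply: hc => i; rewrite !mxE.
    have h1 := floor_le (k%:R * x 0 i); have := floorD1_gt (k%:R * x 0 i).
    by rewrite intrD ler_norml => h2; apply/andP; split; lra.
  exists (index (z + u) s); first by rewrite /= mem_index_iota /= index_mem.
  move=> i; rewrite !mxE nth_index // !mxE addrK ltr_pdivrMr // ltr_pdivlMr //.
  have h1 := floor_le (k%:R * x 0 i); have := floorD1_gt (k%:R * x 0 i).
  rewrite intrD => h2; rewrite [x 0 i * _]mulrC h2 andbT.
  by rewrite (lt_le_trans _ h1) // gtrDl oppr_lt0 invr_gt0.
rewrite lee_fin.
under eq_bigr do under eq_bigr do rewrite ab_sub.
under eq_bigr do rewrite prodr_const card_ord.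
rewrite sumr_const_nat subn0 p_count -[leLHS]mulr_natl.
exact: lexx.
Qed.

(** Finite covers give the lower bound. For the upper one, [lebesgue_outer_le_count] multiplied by
    [k ^ (2 n)] compares [vol P * k ^ (2 n)] with [p(k + c) (k + 1)^n], and the coefficients at
    [2 n] are [vol P] and that of [p] at [n]. *)
Lemma vol_top_coef : vol P = p`_n.
Proof.
have [c c_gt0 hc] := lebesgue_outer_le_count.
have ge : ((p`_n)%:E <= lebesgue_outer P)%E.
  by apply: hull_lebesgue_outer_ge => N D a b; exact: top_coef_le_cover.
have fin : lebesgue_outer P \is a fin_num.
  by rewrite fin_numElt (lt_le_trans (ltNyr _) ge) (le_lt_trans (hc 1%N _)) // ltry.
move: ge; rewrite -(fineK fin) lee_fin -/(vol P) => ge.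
apply/eqP; rewrite eq_le ge andbT.
have [sq qn] := coef_comp_XDC_top c%:R size_p.
pose r := (p \Po ('X + c%:R%:P)) * ('X + 1%:P) ^+ n.
have X1E : 'X + 1%:P = 'X - (-1)%:P :> {poly R} by rewrite polyCN opprK.
have sX1 : (size (('X + 1%:P) ^+ n : {poly R}) <= n.+1)%N by rewrite X1E size_exp_XsubC.
have rn : r`_(n + n) = p`_n.
  rewrite coefM_top // qn; have /monicP := monic_exp n (monicXsubC (-1 : R)).
  by rewrite lead_coefE size_exp_XsubC -X1E => ->; rewrite mulr1.
rewrite -rn.
have <- : (vol P *: 'X ^+ (n + n))`_(n + n) = vol P by rewrite coefZ coefXn eqxx mulr1.
apply: (@le_top_coef _ _ _ _ 1).
- by rewrite (leq_trans (size_scale_leq _ _)) // size_polyXn.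
- exact: size_polyM_le.
move=> k k_gt0; have k0 : 0 < k%:R :> R by rewrite ltr0n.
rewrite hornerZ hornerXn hornerM horner_comp horner_exp !hornerD !hornerX !hornerC.
have := hc k k_gt0; rewrite -(fineK fin) lee_fin -/(vol P) expr_div_n mulrA.
by rewrite ler_pdivlMr ?exprn_gt0 // -exprM mul2n -addnn natrD natr1.
Qed.

End Volume.

(** * The Ehrhart polynomial and the three estimates *)

Section Ehrhart.
Variables (R : realType) (n : nat) (P : set 'rV[R]_n).

Lemma lattice_count_dilate0 : P !=set0 -> lattice_count (dilate 0 P) = 1%N.
Proof.
move=> P0; rewrite dilate0 // /lattice_count (_ : [set z | _] = [set 0]).
  by rewrite fset_set1 cardfs1.
apply/seteqP; split=> z /=; last by move=> ->; rewrite /of_lattice map_mx0.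
move=> /rowP z0; apply/rowP => i; have := z0 i; rewrite !mxE => /eqP.
by rewrite intr_eq0 => /eqP.
Qed.

(** [xget] returns either a polynomial with the defining property or the default 0. *)
Lemma ehrhart_polyP : ehrhart_poly P != 0 ->
  (size (ehrhart_poly P) <= n.+1)%N /\
  forall k : nat, (ehrhart_poly P).[k%:R] = (lattice_count (dilate k%:R P))%:R.
Proof. by rewrite /ehrhart_poly; case: xgetP => [p -> [] //|_]; rewrite eqxx. Qed.

End Ehrhart.

Theorem theorem3p1 (R : realType) (n : nat) (P : set 'rV[R]_n) (a : R)
    (hP : lattice_polytope P) (hdim : full_dimensional P) (ha : 0 < a)
    (hroots : forall z : R[i], root (ehrhart_polyC P) z -> complex.Re z = - (1 / a)) :
  let G := ehrhart_coef P in
  let cube := forall k : nat,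
    (lattice_count (dilate k%:R P))%:R = (a * k%:R + 1) ^+ n in
  (* (i) *)
  [/\ forall s t : nat, (s < t)%N -> (t <= n)%N ->
        G t / G s <= a ^+ (t - s) * ('C(n, t)%:R / 'C(n, s)%:R),
      forall s t : nat, (s < t)%N -> (t <= n)%N -> (s, t) = (n.-1, n) ->
        G t / G s = a ^+ (t - s) * ('C(n, t)%:R / 'C(n, s)%:R) &
      forall s t : nat, (s < t)%N -> (t <= n)%N -> (s, t) <> (n.-1, n) ->
        (G t / G s = a ^+ (t - s) * ('C(n, t)%:R / 'C(n, s)%:R) <-> cube)] /\
  (* (ii) *)
  (vol P <= (a / (a + 1)) ^+ n * (lattice_count P)%:R /\
   (vol P = (a / (a + 1)) ^+ n * (lattice_count P)%:R <-> cube)) /\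
  (* (iii) *)
  let bound := (a + 1) ^ (n%:Z - 2) * (a + 2) / a ^ (n%:Z - 1) * vol P
               + (a + 1) ^ (n%:Z - 2) in
  [/\ (lattice_count P)%:R <= bound,
      (lattice_count P)%:R = bound <->
        at_most_one_conjugate_pair (ehrhart_polyC P) &
      n = 2%N \/ n = 3%N -> (lattice_count P)%:R = bound].
Proof.
have [m [v PE]] := hP; subst P; set P := convex_hull _ in hP hdim hroots *.
(* The zero polynomial would have the root 0, whose real part is not [-1/a]. *)
have ez0 : ehrhart_poly P != 0.
  apply/eqP => e0; have := hroots 0; rewrite /ehrhart_polyC e0 map_poly0 root0 => /(_ isT) /= /eqP.
  by rewrite eq_sym oppr_eq0 div1r invr_eq0 gt_eqF.
have [size_p p_count] := ehrhart_polyP ez0.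
move=> G cube.
have P0 : P !=set0 by exact: (full_dimensional_nonempty hdim).
have volE : vol P = G n.
  exact: (vol_top_coef size_p p_count hdim).
have Gn_gt0 : 0 < G n.
  exact: (top_coef_gt0 size_p p_count hdim).
have p0 : (ehrhart_poly P).[0] = 1 by rewrite -(mulr0n 1) p_count lattice_count_dilate0.
have countE : (lattice_count P)%:R = (ehrhart_poly P).[1].
  by rewrite -[1 in RHS]/(1%:R) p_count dilate1.
have [c [bs [r [bs_gt0 pE]]]] := line_poly_factorization ha ez0 hroots.
pose E j := (\prod_(b <- bs) ('X + b%:P))`_j.
have E_gt0 j : (j <= size bs)%N -> 0 < E j by exact: coef_prod_XDC_gt0.
have GE t : G t = \sum_(j < (size bs).+1) c * E j * (a ^+ t *+ 'C(2 * j + r, t)).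
  by rewrite /G /ehrhart_coef pE coef_line_poly.
(* The value 1 at [k = 0] is [c] times the sum of the nonnegative [E j]. *)
have c_gt0 : 0 < c.
  have : c * \sum_(j < (size bs).+1) E j = 1.
    rewrite -p0 pE horner_line_poly mulr_sumr; apply: eq_bigr => j _.
    by rewrite mulr0 add0r expr1n mulr1.
  have S_ge0 : 0 <= \sum_(j < (size bs).+1) E j.
    by apply: sumr_ge0 => j _; rewrite ltW ?E_gt0 // -ltnS.
  move=> cS; have : (0 : R) < 1 := ltr01; rewrite -cS pmulr_lgt0 // lt_neqAle S_ge0 andbT.
  by apply/eqP => S0; move: cS; rewrite -S0 mulr0 => /eqP; rewrite eq_sym oner_eq0.
(* The degree of the factorization is [n]: positivity of [G n] gives one inequality, and the size
   bound on the Ehrhart polynomial together with a positive top coefficient gives the other. *)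
have nE : n = (2 * size bs + r)%N.
  apply/eqP; rewrite eqn_leq; apply/andP; split.
    rewrite leqNgt; apply/negP => lt; move: Gn_gt0; rewrite GE big1 ?ltxx // => j _.
    rewrite bin_small ?mulr0 //; apply: leq_ltn_trans lt.
    by rewrite leq_add2r leq_mul2l /= -ltnS.
  rewrite leqNgt; apply/negP => lt.
  have := combination_coef_gt0 ha c_gt0 E_gt0 (leqnn (2 * size bs + r)).
  by rewrite -GE /G /ehrhart_coef nth_default ?ltxx // (leq_trans size_p).
have HE : (lattice_count P)%:R = \sum_(j < (size bs).+1) c * E j * (a + 1) ^+ (2 * j + r).
  by rewrite countE pE horner_line_poly; apply: eq_bigr => j _; rewrite mulr1.
have cube_coef : cube -> forall t, G t = a ^+ t *+ 'C(n, t).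
  move=> hc t; rewrite -(coef_line_power a) -[G t]/((ehrhart_poly P)`_t).
  suff -> : ehrhart_poly P = (1 + a *: 'X) ^+ n by [].
  apply: eq_poly_nat => k.
  by rewrite p_count hc horner_exp hornerD hornerZ hornerX hornerC addrC.
have cube_count : cube -> (lattice_count P)%:R = (a + 1) ^+ n.
  by move=> hc; have := hc 1%N; rewrite mulr1 dilate1.
(* Under [cube], the top coefficient [a ^+ n] and the value [(a + 1) ^+ n] at 1 are in the extremal
   ratio, which [combination_top_lt] forbids when [bs] is nonempty. *)
have cubeP : cube <-> size bs = 0%N.
  split=> [hc|bs0 k].
    apply/eqP; rewrite -leqn0 leqNgt; apply/negP => /(combination_top_lt r ha c_gt0 E_gt0).
    rewrite -GE -HE -nE (cube_coef hc) (cube_count hc) binn mulr1n -exprMn divfK ?ltxx //.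
    by rewrite gt_eqF // addr_gt0.
  have cE0 : c * E 0%N = 1.
    by rewrite -p0 pE horner_line_poly bs0 big_ord1 mulr0 add0r expr1n mulr1.
  rewrite -p_count pE horner_line_poly bs0 big_ord1.
  by rewrite -/(E 0%N) cE0 mul1r [n in RHS]nE bs0.
have G0 : G 0%N = 1 by rewrite /G /ehrhart_coef -horner_coef0.
split; last split; [split| |].
- move=> s t st tn; have := @combination_ratio_le _ _ _ _ _ r ha c_gt0 E_gt0 s t.
  by rewrite -!GE -nE st tn; apply.
- move=> s t st tn [-> ->]; have := @combination_ratio_top _ _ _ _ _ r ha c_gt0 E_gt0.
  by rewrite -!GE -nE; apply; exact: leq_trans (leq_ltn_trans (leq0n s) st) tn.
- move=> s t st tn st_n; split=> [eqG|hc].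
    apply/cubeP/eqP; rewrite -leqn0 leqNgt; apply/negP => bs_n0.
    have := @combination_ratio_lt _ _ _ _ _ r ha c_gt0 E_gt0 s t.
    rewrite -!GE -nE st tn eqG ltxx => /(_ isT bs_n0) lt; suff /lt : (s.+1 < n)%N by [].
    (* If [s + 1 = n], then [s < t <= n] forces [t = n], the excluded pair. *)
    rewrite ltn_neqAle (leq_trans st tn) andbT; apply/eqP => sn; apply: st_n.
    by rewrite -sn /=; congr (_, _); apply/eqP; rewrite eqn_leq st sn tn.
  rewrite !cube_coef // -[a ^+ t *+ _]mulr_natr -[a ^+ s *+ _]mulr_natr.
  rewrite -{1}(subnK (ltnW st)) exprD; field.
  rewrite expf_neq0 ?gt_eqF //= ltr0n bin_gt0; exact: ltnW (leq_trans st tn).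
- rewrite volE; split.
    have := combination_top_le r ha c_gt0 E_gt0.
    by rewrite -GE -HE -nE.
  split=> [eqV|hc].
    apply/cubeP/eqP; rewrite -leqn0 leqNgt; apply/negP.
    move=> /(combination_top_lt r ha c_gt0 E_gt0).
    by rewrite -GE -HE -nE -eqV ltxx.
  rewrite (cube_coef hc) (cube_count hc) binn mulr1n -exprMn divfK //.
  by rewrite gt_eqF // addr_gt0.
move=> bound.
have bE : ((lattice_count P)%:R == bound) = (size bs <= 1)%N.
  have := @combination_bound_eq _ _ _ _ _ r ha c_gt0 E_gt0.
  by rewrite -!GE -HE -nE -volE; apply.
split.
- have := @combination_bound _ _ _ _ _ r ha c_gt0 E_gt0.
  by rewrite -!GE -HE -nE -volE; apply.
- rewrite /ehrhart_polyC pE at_most_one_pair_line_poly ?gt_eqF // -bE.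
  by split=> /eqP.
(* A degree [2 * size bs + r] of at most 3 leaves room for one quadratic factor. *)
move=> n23; apply/eqP; rewrite bE; move: n23; rewrite nE; lia.
Qed.
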